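(* For every integer $k\geq 18$ with $k\equiv 2\pmod 4$, there exists a $k$-ARCS$(2k+1)$ (an almost resolvable $k$-cycle system of order $2k+1$).
   Context: $K_v$ denotes the complete graph on $v$ vertices. A $k$-cycle is a cycle of length $k$. A $k$-cycle system of order $v$ is a collection of $k$-cycles (subgraphs of $K_v$) whose edge sets partition $E(K_v)$. In a $k$-cycle system of order $v\equiv 1\pmod{2k}$, an almost parallel class is a collection of $(v-1)/k$ pairwise vertex-disjoint $k$-cycles of the system, and a half-parallel class is a collection of $(v-1)/(2k)$ pairwise vertex-disjoint $k$-cycles of the system. For $v\equiv 1\pmod{2k}$, an almost resolvable $k$-cycle system of order $v$, denoted $k$-ARCS$(v)$, is a $k$-cycle system of order $v$ whose set of cycles can be partitioned into $(v-1)/2$ almost parallel classes and one half-parallel class. *)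

(* Defs.v *)
From mathcomp Require Import all_boot.

Set Implicit Arguments.
Unset Strict Implicit.
Unset Printing Implicit Defensive.

(* MathComp development.  A subgraph of the complete graph on V without
   isolated vertices is represented by its set of edges, an edge being a
   2-element set of vertices; its vertex set is then the union [cover C] of
   its edges. *)

Definition complete_edges (V : finType) : {set {set V}} :=
  [set e : {set V} | #|e| == 2].

(* [next s x] is the cyclic successor of x in s, so the last vertex of s is
   joined to the first one. *)
Definition cycle_edges (V : finType) (s : seq V) : {set {set V}} :=
  [set [set x; next s x] | x in s].

Definition is_kcycle (V : finType) (k : nat) (C : {set {set V}}) : Prop :=
  2 < k /\ exists s : k.-tuple V, uniq s /\ C = cycle_edges s.

Definition kcycle_system (k v : nat) (S : {set {set {set 'I_v}}}) : Prop :=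
  (forall C, C \in S -> is_kcycle k C) /\ partition S (complete_edges 'I_v).

Definition vertex_disjoint (V : finType) (P : {set {set {set V}}}) : Prop :=
  forall C D, C \in P -> D \in P -> C != D -> [disjoint cover C & cover D].

Definition almost_parallel_class (k v : nat) (S P : {set {set {set 'I_v}}}) :
  Prop := [/\ P \subset S, #|P| = (v - 1) %/ k & vertex_disjoint P].

Definition half_parallel_class (k v : nat) (S P : {set {set {set 'I_v}}}) :
  Prop := [/\ P \subset S, #|P| = (v - 1) %/ (2 * k) & vertex_disjoint P].

(* [partition] demands nonempty blocks, so the degenerate order v = 1, whose
   only classes would be empty, is not covered. *)
Definition is_ARCS (k v : nat) (S : {set {set {set 'I_v}}}) : Prop :=
  [/\ v = 1 %[mod 2 * k], kcycle_system k S &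
    exists (A : {set {set {set {set 'I_v}}}}) (H : {set {set {set 'I_v}}}),
      [/\ H \notin A,
          partition (H |: A) S,
          #|A| = (v - 1) %/ 2,
          forall P, P \in A -> almost_parallel_class k S P
        & half_parallel_class k S H]].

(* Main.v *)
Require Import Defs.
From mathcomp Require Import all_boot zify.

(** Write k = 2 m with m = 2 t + 1, and take as vertices Z_m x {0, 1, 2, 3}
    together with a point at infinity.  The group Z_m acts by translation, and
    everything is developed from two almost parallel classes with two k-cycles
    each ([base_cycle]) and one k-cycle [half_cycle] that is invariant under
    translation.  This gives 2 m = k almost parallel classes and one
    half-parallel class.

    No disjointness of edge sets has to be proved.  There are 2 k + 1 cycles of
    length k, and K_(2k+1) has exactly (2 k + 1) k edges, so cycles that cover
    all edges automatically partition them ([ARCS_of_cover]).  In the same way,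
    two k-cycles that together meet 2 k vertices have no repeated vertex and
    are disjoint.  Because of the translations, covering the edges amounts to
    the following ([ARCS_of_differences]): for all levels i <= j and each
    difference d, some base cycle or the half-parallel cycle has an edge from
    (i, p) to (j, p + d), and infinity is joined to every level.

    The base cycles are built from zigzags (i, x), (j, y), (i, x + 1),
    (j, y - 1), ...  The q-th edge of a zigzag has difference y - x - q from
    level i to level j, so a zigzag of n vertices realizes n - 1 consecutive
    differences while its vertices fill an interval of about n / 2 positions on
    each of the two levels.  There are ten pairs {i, j} with i <= j, and each of
    them receives one long zigzag: m - O(1) edges if i < j, and about m / 2
    edges if i = j, where a zigzag fills half of one level.  Up to a few
    vertices, every level is then filled twice, once in each of the two classes:
    the zigzags 02, 03, 12, 13 make up the first class, and 01, 23, 00, 11, 22,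
    33 the second one.  The few edges that link consecutive zigzags, or pass
    through infinity or a single vertex, realize the differences left over; the
    differences t - 1 and t between levels 2 and 3 are those of the
    half-parallel class.  The positions of the zigzags are chosen so that this
    works for every t >= 3 at once. *)

Set Implicit Arguments.
Unset Strict Implicit.
Unset Printing Implicit Defensive.

(** * Cycles that cover all edges *)

Lemma card_cycle_edges (V : finType) (s : seq V) :
  #|cycle_edges s| <= size s.
Proof.
rewrite /cycle_edges; apply: leq_trans (leq_imset_card _ _) _.
exact: card_size.
Qed.

Lemma next_neq (V : eqType) (s : seq V) x :
  uniq s -> 1 < size s -> x \in s -> next s x != x.
Proof.
move=> us ss /rot_to[i s' es]; rewrite -(next_rot i us) es.
have: uniq (rot i s) by rewrite rot_uniq.
have: 1 < size (rot i s) by rewrite size_rot.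
rewrite es; case: s' {es} => [|y s'] //= _.
by rewrite eqxx inE negb_or eq_sym => /andP[/andP[]].
Qed.

Lemma cycle_edges_complete (V : finType) (s : seq V) :
  uniq s -> 1 < size s -> cycle_edges s \subset complete_edges V.
Proof.
move=> us ss; apply/subsetP => e /imsetP[x xs ->].
by rewrite inE cards2 [x == _]eq_sym next_neq.
Qed.

Lemma cover_cycle_edges (V : finType) (s : seq V) :
  cover (cycle_edges s) \subset s.
Proof.
apply/subsetP => x /bigcupP[_ /imsetP[y ys ->]].
by case/set2P => -> //; rewrite mem_next.
Qed.

(** Covering suffices, by counting: the (2 k + 1) k edges of the complete graph
    are covered by 2 k + 1 sets of at most k edges, so these sets are distinct,
    pairwise disjoint and have exactly k edges.  The cycles [F i true] and
    [F i false] form the almost parallel class of index [i]. *)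
Lemma ARCS_of_cover (k v : nat) (I : finType) (F : I -> bool -> seq 'I_v)
    (h : seq 'I_v) :
  2 < k -> v = (2 * k).+1 -> #|I| = k ->
  (forall i b, size (F i b) = k) -> size h = k ->
  (forall i, uniq (F i true ++ F i false)) -> uniq h ->
  (forall x y : 'I_v, x != y -> [set x; y] \in cycle_edges h \/
     exists i b, [set x; y] \in cycle_edges (F i b)) ->
  exists S : {set {set {set 'I_v}}}, is_ARCS k S.
Proof.
move=> k2 ev cI sF sh uF uh cov.
pose c (o : option (I * bool)) := if o is Some (i, b) then F i b else h.
have sc o : size (c o) = k by case: o => [[i b]|] /=.
have uc o : uniq (c o).
  case: o => [[i b]|] //=; have := uF i; rewrite cat_uniq.
  by case: b; case/and3P.
pose E o := cycle_edges (c o).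
pose S := [set E o | o : option (I * bool)].
have covS : cover S = complete_edges 'I_v.
  apply/eqP; rewrite eqEsubset; apply/andP; split.
    apply/subsetP => e /bigcupP[_ /imsetP[o _ ->]]; apply/subsetP.
    by apply: cycle_edges_complete => //; rewrite sc; lia.
  apply/subsetP => e; rewrite inE => /cards2P[x [y [xy ->]]].
  apply/bigcupP; case: (cov x y xy) => [?|[i [b ?]]].
    by exists (E None) => //; apply: imset_f.
  by exists (E (Some (i, b))) => //; apply: imset_f.
have cO : #|{: option (I * bool)}| = v.
  by rewrite card_option card_prod card_bool cI; lia.
have cS : #|S| <= v by apply: leq_trans (leq_imset_card _ _) _; rewrite cO.
have cE : #|complete_edges 'I_v| = v * k.
  rewrite /complete_edges card_draws card_ord bin2.
  have -> : v.-1 = k.*2 by rewrite ev -mul2n.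
  by rewrite -doubleMr doubleK.
have sumS : \sum_(B in S) #|B| <= #|S| * k.
  rewrite -sum_nat_const; apply: leq_sum => B /imsetP[o _ ->].
  by rewrite (leq_trans (card_cycle_edges _)) ?sc.
(* [leq_card_cover] has equality exactly for pairwise disjoint sets. *)
have [cov_le cov_eq] := leq_card_cover S.
rewrite covS cE in cov_le cov_eq.
have Sv : #|S| = v.
  apply/eqP; rewrite eqn_leq cS -(leq_pmul2r (ltnW (ltnW k2))).
  exact: leq_trans cov_le sumS.
have trS : trivIset S.
  by rewrite -cov_eq eqn_leq cov_le (leq_trans sumS) ?leq_mul2r ?cS ?orbT.
have injE : injective E.
  have /imset_injP injE : #|S| == #|{: option (I * bool)}| by rewrite Sv cO.
  by move=> a b; apply: injE.
have En0 o : E o != set0.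
  have : 0 < size (c o) by rewrite sc; lia.
  case e: (c o) => [|x s'] // _; apply/set0Pn; exists [set x; next (c o) x].
  by apply: imset_f; rewrite e inE eqxx.
have partS : partition S (complete_edges 'I_v).
  rewrite /partition covS eqxx trS /=.
  by apply/imsetP => -[o _ e0]; move: (En0 o); rewrite -e0 eqxx.
pose A i := [set E (Some (i, b)) | b : bool].
have inA i o : (E o \in A i) = (if o is Some (j, _) then j == i else false).
  apply/imsetP/idP => [[b _ /injE->] //|].
  by case: o => [[j b]|] // /eqP->; exists b.
have injA : injective A.
  by move=> i j eA; apply/eqP; have := inA j (Some (i, true)) => <-;
     rewrite -eA inA.
have HnA : [set E None] \notin [set A i | i : I].
  by apply/imsetP => -[i _ eA]; move: (inA i None); rewrite -eA inE eqxx.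
exists S; split.
- have -> : v = 2 * k + 1 by rewrite ev addn1.
  by rewrite modnDl.
- split=> // _ /imsetP[o _ ->]; split=> //.
  have so : size (c o) == k by rewrite sc.
  by exists (Tuple so); split; first exact: uc.
exists [set A i | i : I], [set E None]; split=> //.
- apply/and3P; split.
  + rewrite eqEsubset; apply/andP; split.
      apply/bigcupsP => B; rewrite in_setU1 => /orP[/eqP->|/imsetP[i _ ->]].
        by rewrite sub1set; apply: imset_f.
      by apply/subsetP => _ /imsetP[b _ ->]; apply: imset_f.
    apply/subsetP => _ /imsetP[[[i b]|] _ ->]; apply/bigcupP.
      by exists (A i); rewrite ?inA // in_setU1 imset_f ?orbT.
    by exists [set E None]; rewrite ?set11 // setU11.
  + apply/trivIsetP => B D; rewrite !in_setU1.
    have dis i : [disjoint [set E None] & A i].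
      by rewrite disjoints1 inA.
    move=> /orP[/eqP->|/imsetP[i _ ->]] /orP[/eqP->|/imsetP[j _ ->]].
    * by rewrite eqxx.
    * by [].
    * by rewrite disjoint_sym.
    * move=> ij; rewrite -setI_eq0; apply/eqP/setP => C; rewrite !inE.
      apply/negbTE/negP => /andP[/imsetP[b _ ->]]; rewrite inA => /eqP eij.
      by rewrite eij eqxx in ij.
  + rewrite in_setU1; apply/norP; split.
      by rewrite eq_sym -card_gt0 cards1.
    apply/imsetP => -[i _ e0]; have := inA i (Some (i, true)).
    by rewrite -e0 eqxx inE.
- by rewrite card_imset // cI ev subn1 mulKn.
- move=> _ /imsetP[i _ ->]; split.
  + by apply/subsetP => _ /imsetP[b _ ->]; apply: imset_f.
  + rewrite card_imset; first by rewrite card_bool ev subn1 mulnK //; lia.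
    by move=> b b' /injE[].
  + have dis b :
        [disjoint cover (E (Some (i, b))) & cover (E (Some (i, ~~ b)))].
      wlog: b / b => [W|].
        by case: b; [exact: (W true)|rewrite disjoint_sym; exact: (W true)].
      move=> bT; rewrite {b}bT /=.
      apply: disjointWl (cover_cycle_edges _) _.
      apply: disjointWr (cover_cycle_edges _) _.
      have := uF i; rewrite cat_uniq => /and3P[_ + _].
      by rewrite disjoint_sym disjoint_has.
    move=> _ _ /imsetP[b _ ->] /imsetP[b' _ ->] bb'.
    suff -> : b' = ~~ b by [].
    by case: b b' bb' => [] []; rewrite ?eqxx.
- split; first by rewrite sub1set; apply: imset_f.
  + by rewrite cards1 ev subn1 /= divnn muln_gt0 (ltnW (ltnW k2)).
  + by move=> C D /set1P-> /set1P->; rewrite eqxx.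
Qed.

Definition adjacent (T : Type) (s : seq T) (u v : T) : Prop :=
  exists s1 s2, s = s1 ++ [:: u, v & s2] \/ s = s1 ++ [:: v, u & s2].

Lemma adjacent_sym (T : Type) (s : seq T) (u v : T) :
  adjacent s u v -> adjacent s v u.
Proof. by case=> s1 [s2 []->]; exists s1, s2; [right|left]. Qed.

Lemma adjacent_catl (T : Type) (s s' : seq T) (u v : T) :
  adjacent s u v -> adjacent (s ++ s') u v.
Proof.
by case=> s1 [s2 []->]; exists s1, (s2 ++ s'); rewrite -catA; [left|right].
Qed.

Lemma adjacent_catr (T : Type) (s s' : seq T) (u v : T) :
  adjacent s' u v -> adjacent (s ++ s') u v.
Proof.
by case=> s1 [s2 []->]; exists (s ++ s1), s2; rewrite -!catA; [left|right].
Qed.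

Lemma adjacent_rev (T : Type) (s : seq T) (u v : T) :
  adjacent s u v -> adjacent (rev s) u v.
Proof.
case=> s1 [s2 []->]; exists (rev s2), (rev s1);
  rewrite rev_cat !rev_cons -!cats1 -!catA /=; [by right|by left].
Qed.

Lemma adjacent_nth (T : Type) (x0 : T) (s : seq T) n :
  n.+1 < size s -> adjacent s (nth x0 s n) (nth x0 s n.+1).
Proof.
move=> ns; exists (take n s), (drop n.+2 s); left.
by rewrite -!drop_nth ?cat_take_drop // ltnW.
Qed.

Lemma adjacent_map (T T' : Type) (f : T -> T') s u v :
  adjacent s u v -> adjacent (map f s) (f u) (f v).
Proof.
by case=> s1 [s2 []->]; exists (map f s1), (map f s2); rewrite map_cat;
  [left|right].
Qed.

(** Doubling the sequence makes its last vertex adjacent to its first one, so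
    that no separate treatment of the closing edge is needed. *)
Lemma adjacent_cycle_edges (V : finType) (s : seq V) u v :
  uniq s -> adjacent (s ++ s) u v -> [set u; v] \in cycle_edges s.
Proof.
move=> us; have: sorted (frel (next s)) (s ++ s).
  have := cycle_next us; case: s {us} => [|x s] //= cs.
  by rewrite -cat_rcons cat_path cs last_rcons; move: cs; rewrite rcons_path;
     case/andP.
move=> + [s1 [s2 es]]; have us2 w : w \in s ++ s -> w \in s.
  by rewrite mem_cat orbb.
have nextP a b : sorted (frel (next s)) (s1 ++ [:: a, b & s2]) -> next s a = b.
  by case: s1 {es} => [|? ?] /=; rewrite ?cat_path /=;
     [case/andP=> /eqP|case/and4P=> _ _ /eqP].
case: es => es; rewrite es => /nextP <-; last rewrite setUC;
  by apply: imset_f; apply: us2; rewrite es mem_cat !inE eqxx !orbT.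
Qed.

(** * Developing base cycles modulo m *)

(** The pair (l, p) with l < 4 is the residue of p on level l.  Every pair on
    level 4 is the point at infinity, which makes it fixed by [shift]. *)
Definition point (m : nat) (u : nat * nat) : 'I_(4 * m).+1 :=
  inord (if u.1 < 4 then u.1 * m + u.2 %% m else 4 * m).

Definition shift (c : nat) (u : nat * nat) := (u.1, u.2 + c).

Lemma residue_shift m (m0 : 0 < m) p q : exists2 c, c < m & p + c = q %[mod m].
Proof.
exists ((q + (m - p %% m)) %% m); first exact: ltn_pmod.
have le : p %% m <= m by rewrite ltnW // ltn_pmod.
rewrite modnDmr; have -> : p + (q + (m - p %% m)) = (p %/ m).+1 * m + q.
  by rewrite {1}(divn_eq p m) mulSn; lia.
by rewrite modnMDl.
Qed.

Lemma point_mod m l p q : p = q %[mod m] -> point m (l, p) = point m (l, q).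
Proof. by rewrite /point /= => ->. Qed.

Lemma val_point m (m0 : 0 < m) l p : l < 4 ->
  val (point m (l, p)) = l * m + p %% m.
Proof.
move=> l4; rewrite /point /= l4 inordK //.
by have := ltn_pmod p m0; nia.
Qed.

Lemma point_inj m (m0 : 0 < m) l p l' p' : l < 4 -> l' < 4 ->
  point m (l, p) = point m (l', p') -> l = l' /\ p = p' %[mod m].
Proof.
move=> l4 l4' /(congr1 val); rewrite !val_point // => e; split.
  have := congr1 (divn^~ m) e.
  by rewrite !divnMDl // !(divn_small (ltn_pmod _ m0)) !addn0.
by have := congr1 (modn^~ m) e; rewrite !modnMDl !modn_mod.
Qed.

Lemma point_surj m (m0 : 0 < m) (x : 'I_(4 * m).+1) :
  x = point m (4, 0) \/ exists l p, [/\ l < 4, p < m & x = point m (l, p)].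
Proof.
have := ltn_ord x; rewrite ltnS leq_eqVlt => /orP[/eqP e|lx].
  by left; apply: val_inj; rewrite /= e inordK.
right; exists (x %/ m), (x %% m).
have l4 : x %/ m < 4 by rewrite ltn_divLR.
split=> //; first exact: ltn_pmod.
by apply: val_inj; rewrite val_point // modn_mod -divn_eq.
Qed.

Definition joins (m : nat) (s : seq (nat * nat)) (i j d : nat) : Prop :=
  exists p q, adjacent s (i, p) (j, q) /\ p + d = q %[mod m].

(** The almost parallel classes are the translates of the classes
    {B a true, B a false}.  The vertices of such a class are distinct because
    its 2 k entries already meet all vertices but the one called [w]; an entry
    may represent its residue p by p + m.  The difference of an edge within one
    level is only defined up to sign, whence the restriction to 2 d <= m if
    i = j.  The last alternative says that [h] contains all translates of an
    edge, since [h] is not translated itself. *)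
Lemma ARCS_of_differences (k m : nat) (B : bool -> bool -> seq (nat * nat))
    (h : seq (nat * nat)) :
  2 < k -> k = 2 * m ->
  (forall a b, size (B a b) = k) -> size h = k -> uniq (map (point m) h) ->
  (forall a, exists w, forall l p, l < 4 -> p < m -> (l, p) != w ->
     (l, p) \in B a true ++ B a false \/
     (l, p + m) \in B a true ++ B a false) ->
  (forall a, (4, 0) \in B a true ++ B a false) ->
  (forall i, i < 4 -> exists d a b, joins m (B a b ++ B a b) i 4 d) ->
  (forall i j d, i <= j -> j < 4 -> d < m -> (i = j -> 0 < d /\ 2 * d <= m) ->
     (exists a b, joins m (B a b ++ B a b) i j d) \/
     (forall p, exists p' q, [/\ adjacent (h ++ h) (i, p') (j, q),
         p' = p %[mod m] & q = p + d %[mod m]])) ->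
  exists S : {set {set {set 'I_(4 * m).+1}}}, is_ARCS k S.
Proof.
move=> k2 ek sB sh uh vB infB infd dB.
have m0 : 0 < m by lia.
pose F (i : 'I_m * bool) b := map (point m \o shift i.1) (B i.2 b).
have uF i : uniq (F i true ++ F i false).
  case: i => c a; rewrite /F /= -map_cat.
  have [[l0 p0] vw] := vB a.
  pose x0 := point m (l0, p0 + c).
  apply: (@leq_size_uniq _ (enum (predC1 x0))); first exact: enum_uniq.
    move=> x; rewrite mem_enum inE /= => xx0.
    have [->|[l [p [l4 pm ex]]]] := point_surj m0 x.
      apply/mapP; exists (4, 0); first exact: infB.
      by rewrite /shift /= /point.
    pose q := (p + (m - c)) %% m.
    have cm : c <= m by exact: ltnW.
    have eq : q + c = p %[mod m].
      by rewrite /q modnDml -addnA subnK // modnDr.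
    have nw : (l, q) != (l0, p0).
      apply: contra xx0 => /eqP[el ep].
      by rewrite ex /x0 -el -ep; apply/eqP; apply: point_mod.
    have qm : q < m by exact: ltn_pmod.
    have [qB|qB] := vw l q l4 qm nw; apply/mapP.
      by exists (l, q) => //; rewrite ex; apply: point_mod.
    exists (l, q + m) => //; rewrite ex; apply: point_mod => /=.
    by rewrite addnAC modnDr.
  rewrite -cardE cardC1 card_ord size_map size_cat !sB /=; lia.
have edgeF (x y : 'I_(4 * m).+1) c a b u v : c < m ->
    adjacent (B a b ++ B a b) u v -> x = point m (shift c u) ->
    y = point m (shift c v) ->
    exists i b, [set x; y] \in cycle_edges (F i b).
  move=> cm uv -> ->; exists (Ordinal cm, a), b; apply: adjacent_cycle_edges.
    by have := uF (Ordinal cm, a); rewrite cat_uniq; case: b {uv} => /and3P[].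
  by rewrite -map_cat; apply: adjacent_map uv.
apply: (@ARCS_of_cover k _ ('I_m * bool)%type F (map (point m) h)) => //.
- lia.
- by rewrite card_prod card_ord card_bool ek mulnC.
- by move=> i b; rewrite size_map.
- by rewrite size_map.
move=> x y.
pose good (x y : 'I_(4 * m).+1) :=
  [set x; y] \in cycle_edges (map (point m) h) \/
  exists i b, [set x; y] \in cycle_edges (F i b).
rewrite -/(good x y).
have good_sym x' y' : good x' y' -> good y' x' by rewrite /good setUC.
have good_inf l p : l < 4 -> p < m -> good (point m (l, p)) (point m (4, 0)).
  move=> l4 pm; have [d [a [b [q [q' [qB _]]]]]] := infd l l4; right.
  have [c cm qc] := residue_shift m0 q p.
  by apply: (edgeF _ _ c a b _ _ cm qB) => //; apply: point_mod.
have good_fin i j p q : i <= j -> j < 4 -> p < m -> q < m ->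
    (i = j -> p <> q /\ 2 * ((q + (m - p)) %% m) <= m) ->
    good (point m (i, p)) (point m (j, q)).
  move=> ij j4 pm qm pq; pose d := (q + (m - p)) %% m.
  have dm : d < m by exact: ltn_pmod.
  have pd : p + d = q %[mod m].
    by rewrite /d modnDmr addnCA subnKC ?modnDr // ltnW.
  have ijd : i = j -> 0 < d /\ 2 * d <= m.
    move=> e; have [npq ->] := pq e; split=> //; rewrite lt0n.
    apply/eqP => d0; apply: npq; move: pd; rewrite d0 addn0.
    by rewrite !modn_small.
  have [[a [b [p' [q' [ab e]]]]]|dh] := dB i j d ij j4 dm ijd.
  - right; have [c cm pc] := residue_shift m0 p' p.
    apply: (edgeF _ _ c a b _ _ cm ab); first exact: point_mod.
    apply: point_mod; rewrite /= -modnDml -e modnDml addnAC -modnDml pc modnDml.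
    by rewrite pd.
  - left; have [p' [q' [ab ep eq]]] := dh p.
    rewrite (point_mod i (esym ep)) (point_mod j (etrans (esym pd) (esym eq))).
    by apply: adjacent_cycle_edges => //; rewrite -map_cat; apply: adjacent_map.
have [->|[i [p [i4 pm ->]]]] := point_surj m0 x;
  have [->|[j [q [j4 qm ->]]]] := point_surj m0 y => xy.
- by rewrite eqxx in xy.
- by apply: good_sym; apply: good_inf.
- exact: good_inf.
case: (ltngtP i j) => ij.
- by apply: good_fin => //; [exact: ltnW|lia].
- by apply: good_sym; apply: good_fin => //; [exact: ltnW|lia].
have npq : p <> q by move=> e; rewrite ij e eqxx in xy.
have [le|lt] := leqP (2 * ((q + (m - p)) %% m)) m.
  by apply: good_fin => //; rewrite ij.
apply: good_sym; apply: good_fin; rewrite ?ij // => _; split; first by lia.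
case: (ltngtP p q) => pq; last by case: npq.
- move: lt; have -> : q + (m - p) = q - p + m by lia.
  rewrite modnDr !modn_small; lia.
- move: lt; have -> : p + (m - q) = p - q + m by lia.
  rewrite modnDr !modn_small; lia.
Qed.

(** * Zigzags *)

Definition zig (i x j y n : nat) : seq (nat * nat) :=
  mkseq (fun q => if odd q then (j, y - q./2) else (i, x + q./2)) n.

(** Two zigzags, each filling the interval of n positions from x on one level:
    the first one runs from the ends of the interval to its middle and the
    second one runs back on another level.  Which vertex is the middle one
    depends on the parity of n, but in either case the edge between the levels
    has difference 0. *)
Definition fold2 (i j x n : nat) : seq (nat * nat) :=
  zig i x i (x + n - 1) n ++ rev (zig j x j (x + n - 1) n).

Lemma mem_zig i x j y n l p : n./2 <= y.+1 ->
  ((l, p) \in zig i x j y n) =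
  [&& l == i, x <= p & 2 * (p - x) < n] ||
  [&& l == j, p <= y & 2 * (y - p) + 1 < n].
Proof.
move=> ny; apply/mapP/orP => [[q]|].
  rewrite mem_iota => qn; case: ifP => oq [-> ->]; [right|left];
    rewrite eqxx /=; lia.
case=> /and3P[/eqP-> le lt].
  exists (2 * (p - x)); first by rewrite mem_iota.
  by rewrite mul2n odd_double doubleK subnKC.
exists (2 * (y - p) + 1); first by rewrite mem_iota.
have -> : odd (2 * (y - p) + 1) by lia.
congr (_, _); lia.
Qed.

Lemma mem_fold2 i j x n l p :
  ((l, p) \in fold2 i j x n) = ((l == i) || (l == j)) && (x <= p < x + n).
Proof.
case: n => [|n]; first by rewrite /fold2 /zig /= in_nil; lia.
rewrite /fold2 mem_cat mem_rev !mem_zig; [|lia..].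
by case: (l == i); case: (l == j); rewrite /= ?orbF; lia.
Qed.

Lemma eq_mod_add m a b z w : a + z * m = b + w * m -> a = b %[mod m].
Proof.
by move=> e; rewrite -(modnMDl z a m) -(modnMDl w b m) addnC e addnC.
Qed.

Lemma joins_catl m s s' i j d : joins m s i j d -> joins m (s ++ s') i j d.
Proof.
by case=> p [q [a e]]; exists p, q; split=> //; apply: adjacent_catl.
Qed.

Lemma joins_catr m s s' i j d : joins m s' i j d -> joins m (s ++ s') i j d.
Proof.
by case=> p [q [a e]]; exists p, q; split=> //; apply: adjacent_catr.
Qed.

Lemma joins_rev m s i j d : joins m s i j d -> joins m (rev s) i j d.
Proof.
by case=> p [q [a e]]; exists p, q; split=> //; apply: adjacent_rev.
Qed.

(** Uniform in the parity of q: the q-th edge of a zigzag joins these positions,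
    in an order that depends on the parity. *)
Lemma zig_edge i x j y n q : q.+1 < n ->
  adjacent (zig i x j y n) (i, x + uphalf q) (j, y - q./2).
Proof.
move=> qn; have sz : q.+1 < size (zig i x j y n) by rewrite size_mkseq.
move: (adjacent_nth (0, 0) sz); rewrite !nth_mkseq //; last exact: ltnW.
by rewrite /= uphalf_half; case: (odd q) => //= e; apply: adjacent_sym.
Qed.

(** The parameter z adjusts the difference y - x - q by a multiple of m. *)
Lemma joins_zig m z i x j y n d : n./2 <= y.+1 -> x + d <= y + z * m ->
  (y + z * m - (x + d)).+1 < n -> joins m (zig i x j y n) i j d.
Proof.
move=> ny le lt; do 2!eexists; split; first exact: zig_edge lt.
by apply: (@eq_mod_add _ _ _ 0 z); lia.
Qed.

Lemma joins_zig_down m z i x j y n d : n./2 <= x.+1 -> y + z * m <= x + d ->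
  (x + d - (y + z * m)).+1 < n -> joins m (zig j y i x n) i j d.
Proof.
move=> nx le lt; do 2!eexists; split.
  by apply: adjacent_sym; exact: zig_edge lt.
by apply: (@eq_mod_add _ _ _ 0 z); lia.
Qed.

Definition starts (T : Type) (s : seq T) v := exists s', s = v :: s'.
Definition ends (T : Type) (s : seq T) u := exists s', s = rcons s' u.

Lemma joins_link m z w s1 s2 i j p q d : ends s1 (i, p) -> starts s2 (j, q) ->
  p + d + z * m = q + w * m -> joins m (s1 ++ s2) i j d.
Proof.
case=> s1' -> [s2' ->] /eq_mod_add e; exists p, q; split=> //.
by rewrite cat_rcons; exists s1', s2'; left.
Qed.

Lemma joins_link_sym m z w s1 s2 i j p q d :
  ends s1 (j, q) -> starts s2 (i, p) ->
  p + d + z * m = q + w * m -> joins m (s1 ++ s2) i j d.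
Proof.
case=> s1' -> [s2' ->] /eq_mod_add e; exists p, q; split=> //.
by rewrite cat_rcons; exists s1', s2'; right.
Qed.

Lemma starts_zig i x j y n s : 0 < n -> starts (zig i x j y n ++ s) (i, x).
Proof.
by case: n => // n _; rewrite /zig /mkseq /= addn0; eexists.
Qed.

Lemma ends_zig_odd i x j y n : odd n -> ends (zig i x j y n) (i, x + n./2).
Proof.
case: n => // n on; rewrite /zig mkseqS; eexists; congr rcons.
have /negbTE en : ~~ odd n by [].
by rewrite en /= uphalf_half en.
Qed.

Lemma ends_zig_even i x j y n : 0 < n -> ~~ odd n ->
  ends (zig i x j y n) (j, y - (n./2).-1).
Proof.
case: n => // n _; rewrite /= negbK => on; rewrite /zig mkseqS; eexists.
by rewrite on uphalf_half on.
Qed.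

Lemma ends_rev_zig i x j y n : 0 < n -> ends (rev (zig i x j y n)) (i, x).
Proof.
by case: n => // n _; rewrite /zig /mkseq /= addn0 rev_cons; eexists.
Qed.

Lemma joins_fold2 m i j x n : 0 < n -> joins m (fold2 i j x n) j i 0.
Proof.
case: n => // n _; rewrite /fold2 /zig !mkseqS rev_rcons.
by case: odd; (eapply (@joins_link_sym m 0 0);
  [eexists; reflexivity|eexists; reflexivity|rewrite !addn0]).
Qed.

(** * The base cycles *)

(** Up to a few single vertices the levels are filled as follows, where lo and
    hi stand for the lower and upper half of the residues 0, ..., 2 t.  In the
    first class, level 0 is covered by zigzag 02 on lo and 03 on hi, level 1 by
    12 on lo and 13 on hi, level 2 by 12 on lo and 02 on hi, and level 3 by 13
    on lo and 03 on hi.  In the second class, the folds cover lo and the zigzags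
    01 and 23 cover hi on all levels. *)
Definition cycle1 t := zig 0 0 2 (2 * t) (2 * t - 1) ++
  [:: (3, 2 * t), (4, 0), (1, 0), (0, t), (3, 2 * t - 1) &
   zig 0 (t + 1) 3 (2 * t - 2) (2 * t - 2)].

Definition cycle2 t := zig 1 (t + 1) 3 (t - 1) (2 * t) ++
  zig 1 1 2 t (2 * t) ++ [:: (0, 2 * t); (2, 0)].

Definition cycle3 t := fold2 3 1 1 (t + 1) ++
  zig 2 (t + 2) 3 (2 * t) (2 * t - 1) ++ [:: (2, t + 1)].

Definition cycle4 t := fold2 2 0 1 (t - 1) ++ [:: (0, t), (0, 0) &
  zig 1 (t + 2) 0 (2 * t) (2 * t) ++ [:: (4, 0); (2, t)]].

Definition base_cycle t (a b : bool) : seq (nat * nat) :=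
  if a then if b then cycle1 t else cycle2 t
  else if b then cycle3 t else cycle4 t.

Lemma size_base_cycle t a b : 2 < t -> size (base_cycle t a b) = 4 * t + 2.
Proof.
by move=> t2; case: a b => [] [];
  rewrite /= /cycle1 /cycle2 /cycle3 /cycle4 /fold2
    !size_cat ?size_rev /= ?size_cat ?size_mkseq /=; lia.
Qed.

(** The vertex (2, t + 1) is missed by the first class, and (3, 0) by the
    second one. *)
Lemma vertices_class1 t l p : 2 < t -> l < 4 -> p < 2 * t + 1 ->
  (l, p) != (2, t + 1) -> (l, p) \in cycle1 t ++ cycle2 t.
Proof.
move=> t2 l4 pt; rewrite !(mem_cat, inE) !mem_zig ?xpair_eqE; [|lia..].
by case: l l4 => [|[|[|[|]]]] // _; rewrite /= ?orbF; lia.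
Qed.

Lemma vertices_class2 t l p : 2 < t -> l < 4 -> p < 2 * t + 1 ->
  (l, p) != (3, 0) ->
  (l, p) \in cycle3 t ++ cycle4 t \/
  (l, p + (2 * t + 1)) \in cycle3 t ++ cycle4 t.
Proof.
(* The zigzags 23 and 01 reach the position 2 t + 1, which represents 0. *)
move=> t2 l4 pt; rewrite /cycle3 /cycle4 !(mem_fold2, mem_cat, inE).
rewrite !mem_zig ?xpair_eqE; [|lia..].
case: l l4 => [|[|[|[|]]]] // _; rewrite /= ?orbF; lia.
Qed.

(* [seek] walks along a doubled cycle until it finds, inside a zigzag or between
   two consecutive blocks, an edge of the difference asked for. *)
Ltac starts := first [by apply: starts_zig; lia | eexists; reflexivity].
Ltac ends := first
  [ by apply: ends_rev_zig; lia | by apply: ends_zig_odd; lia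
  | by apply: ends_zig_even; lia | by exists [::] ].
Ltac link := first
  [ eapply (@joins_link _ 0 0); [ends | starts | lia]
  | eapply (@joins_link _ 0 1); [ends | starts | lia]
  | eapply (@joins_link_sym _ 0 0); [ends | starts | lia]
  | eapply (@joins_link_sym _ 0 1); [ends | starts | lia] ].
Ltac zigzag := first
  [ by apply: (@joins_zig _ 0); lia | by apply: (@joins_zig _ 1); lia
  | by apply: (@joins_zig_down _ 0); lia
  | by apply: (@joins_zig_down _ 1); lia ].
Ltac seek := lazymatch goal with
  | |- joins _ (?a :: ?s) _ _ _ =>
      change (a :: s) with ([:: a] ++ s);
      first [link | apply: joins_catr; seek]
  | |- joins _ (zig _ _ _ _ _ ++ _) _ _ _ =>
      first [apply: joins_catl; zigzag | link | apply: joins_catr; seek]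
  | |- joins _ (rev _ ++ _) _ _ _ =>
      first [apply: joins_catl; apply: joins_rev; zigzag | link
            | apply: joins_catr; seek]
  | |- _ => zigzag
  end.

Ltac walk := rewrite ?/cycle1 ?/cycle2 ?/cycle3 ?/cycle4 ?/fold2
  ?(=^~ catA, cat_cons, cat0s).

Definition realized t i j d := exists a b,
  joins (2 * t + 1) (base_cycle t a b ++ base_cycle t a b) i j d.

Ltac on_cycle a b := exists a, b; rewrite /base_cycle; walk; by subst; seek.
Ltac on_fold a b := exists a, b; rewrite /base_cycle /cycle3 /cycle4;
  do 2!apply: joins_catl; subst; apply: joins_fold2; lia.

(** Long intervals of differences come from zigzags.  A difference that is
    singled out is the one of an edge linking two blocks of a cycle. *)
Lemma realized_01 t d : 2 < t -> d < 2 * t + 1 -> realized t 0 1 d.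
Proof.
move=> t2 dm.
have [h|[h|[h|h]]] : d <= t \/ d = t + 1 \/ d = t + 2 \/ t + 3 <= d by lia.
- on_cycle false false.
- on_cycle true true.
- on_cycle false false.
- on_cycle false false.
Qed.

Lemma realized_02 t d : 2 < t -> d < 2 * t + 1 -> realized t 0 2 d.
Proof.
move=> t2 dm; have [h|[h|h]] : d = 0 \/ 0 < d < 3 \/ 3 <= d by lia.
- on_fold false false.
- have [e|e] : d = 1 \/ d = 2 by lia.
  1-2: on_cycle true false.
- on_cycle true true.
Qed.

Lemma realized_03 t d : 2 < t -> d < 2 * t + 1 -> realized t 0 3 d.
Proof.
move=> t2 dm.
have [h|[h|[h|[h|[h|h]]]]] : d + 3 <= t \/ d = t - 2 \/ d = t - 1 \/
  d = t \/ d = t + 1 \/ t + 2 <= d by lia.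
all: on_cycle true true.
Qed.

Lemma realized_12 t d : 2 < t -> d < 2 * t + 1 -> realized t 1 2 d.
Proof.
move=> t2 dm.
have [h|[h|[h|h]]] : d < t \/ d = t \/ d = t + 1 \/ t + 2 <= d by lia.
- on_cycle true false.
- on_cycle true false.
- on_cycle false true.
- on_cycle true false.
Qed.

Lemma realized_13 t d : 2 < t -> d < 2 * t + 1 -> realized t 1 3 d.
Proof.
move=> t2 dm; have [h|[h|h]] : d = 0 \/ 0 < d < 2 * t \/ d = 2 * t by lia.
- on_fold false true.
- on_cycle true false.
- on_cycle true false.
Qed.

Lemma realized_23 t d : 2 < t -> d < 2 * t + 1 -> d <> t -> d.+1 <> t ->
  realized t 2 3 d.
Proof.
move=> t2 dm d1 d2.
have [h|[h|h]] : d + 2 <= t \/ d = t + 1 \/ t + 2 <= d by lia.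
all: on_cycle false true.
Qed.

Lemma realized_pure t i d : 2 < t -> i < 4 -> 0 < d <= t -> realized t i i d.
Proof.
move=> t2 i4 dt.
case: i i4 => [|[|[|[|]]]] // _.
- have [h|[h|h]] : d + 2 <= t \/ d.+1 = t \/ d = t by lia.
  1-3: on_cycle false false.
- on_cycle false true.
- have [h|[h|h]] : d + 2 <= t \/ d.+1 = t \/ d = t by lia.
  + on_cycle false false.
  + on_cycle false false.
  + on_cycle false true.
- on_cycle false true.
Qed.

Lemma realized_infinity t i : 2 < t -> i < 4 -> exists d, realized t i 4 d.
Proof.
move=> t2; case: i => [|[|[|[|]]]] // _.
- by exists t; on_cycle false false.
- by exists 0; on_cycle true true.
- by exists (t + 1); on_cycle false false.
- by exists 1; on_cycle true true.
Qed.

(** * The half-parallel class and the conclusion *)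

(** An edge of difference t is followed by one of difference t - 1 throughout;
    the closing edge also has difference t - 1, because 3 t = t - 1 modulo
    2 t + 1. *)
Definition half_cycle t : seq (nat * nat) :=
  mkseq (fun q => if odd q then (3, t + q./2) else (2, q./2)) (4 * t + 2).

Lemma half_cycle_uniq t : uniq (map (point (2 * t + 1)) (half_cycle t)).
Proof.
rewrite /half_cycle /mkseq -map_comp; apply/mkseq_uniqP => q q' /=.
rewrite !unfold_in /= => qn qn'.
have m0 : 0 < 2 * t + 1 by lia.
case: ifP => oq; case: ifP => oq' /(point_inj m0) [] // _.
  by move/eqP; rewrite eqn_modDl !modn_small; [move/eqP|..]; lia.
by rewrite !modn_small; lia.
Qed.

Lemma half_cycle_edge t p d : d = t \/ d.+1 = t ->
  exists p' q, [/\ adjacent (half_cycle t ++ half_cycle t) (2, p') (3, q),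
    p' = p %[mod 2 * t + 1] & q = p + d %[mod 2 * t + 1]].
Proof.
move=> td; pose s := p %% (2 * t + 1).
have sm : s < 2 * t + 1 by apply: ltn_pmod; lia.
have sp : s = p %[mod 2 * t + 1] by rewrite modn_mod.
have edge q : q.+1 < 4 * t + 2 ->
    adjacent (half_cycle t) (2, uphalf q) (3, t + q./2).
  move=> qn; have sz : q.+1 < size (half_cycle t) by rewrite size_mkseq.
  move: (adjacent_nth (0, 0) sz); rewrite !nth_mkseq //; last exact: ltnW.
  by rewrite /= uphalf_half; case: (odd q) => //= e; apply: adjacent_sym.
case: td => [->|dt].
  exists s, (t + s); split=> //; last by rewrite -modnDmr sp modnDmr addnC.
  apply: adjacent_catl; have := edge (2 * s).
  have -> : uphalf (2 * s) = s by lia.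
  have -> : (2 * s)./2 = s by lia.
  by apply; lia.
have [s0|s0] := posnP s.
  exists 0, (t + 2 * t); split; first last.
  - rewrite -[in RHS]modnDml -sp s0 mod0n add0n -dt -(modnDr d).
    by congr modn; lia.
  - by rewrite -sp s0.
  rewrite /half_cycle; have -> : 4 * t + 2 = (4 * t + 1).+1 by lia.
  rewrite {1}mkseqS; have -> : odd (4 * t + 1) by lia.
  have -> : (4 * t + 1)./2 = 2 * t by lia.
  by rewrite cat_rcons; do 2!eexists; right; rewrite /mkseq /=.
exists s, (s + d); split=> //; last by rewrite -modnDml sp modnDml.
apply: adjacent_catl; have := edge (2 * s - 1).
have -> : uphalf (2 * s - 1) = s by lia.
have -> : t + (2 * s - 1)./2 = s + d by lia.
by apply; lia.
Qed.

Theorem lemma3p1 (k : nat) (hk : 18 <= k) (hk4 : k = 2 %[mod 4]) :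
  exists S : {set {set {set 'I_(2 * k + 1)}}}, is_ARCS k S.
Proof.
pose t := k %/ 4.
have [t2 ek] : 2 < t /\ k = 2 * (2 * t + 1) by rewrite /t; lia.
have -> : 2 * k + 1 = (4 * (2 * t + 1)).+1 by lia.
apply: (@ARCS_of_differences _ _ (base_cycle t) (half_cycle t)) => //.
- lia.
- by move=> a b; rewrite size_base_cycle //; lia.
- by rewrite size_mkseq; lia.
- exact: half_cycle_uniq.
- case; [exists (2, t + 1)|exists (3, 0)] => l p l4 pm nw.
    by left; apply: vertices_class1.
  exact: vertices_class2.
- by case; rewrite /base_cycle /cycle1 /cycle4 !(mem_cat, inE) /= !orbT.
- by move=> i; apply: realized_infinity.
move=> i j d ij j4 dm ijd.
have [e|ne] := eqVneq i j.
  by left; rewrite e; apply: realized_pure => //; have := ijd e; lia.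
have {ij ne}ij : i < j by rewrite ltn_neqAle ne.
case: j j4 dm {ijd} ij => [|[|[|[|j]]]] //; case: i => [|[|[|i]]] // _ dm _.
- left; exact: realized_01.
- left; exact: realized_02.
- left; exact: realized_12.
- left; exact: realized_03.
- left; exact: realized_13.
have [td|ntd] : (d = t \/ d.+1 = t) \/ (d <> t /\ d.+1 <> t) by lia.
  by right=> p; apply: half_cycle_edge.
by left; case: ntd => n1 n2; apply: realized_23.
Qed.
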